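(* Let $\widehat T=[-1,1]^2$. For every vector field $(\hat u,\hat v)\in C^1(\widehat T)^2$, $$\nabla\cdot\bigl(\widehat I_{\boldsymbol V}^c(\hat u,\hat v)^T\bigr)=\widehat I_Q^c\bigl(\nabla\cdot(\hat u,\hat v)^T\bigr),$$ i.e. the interpolation operators $\widehat I_{\boldsymbol V}^c:C^1(\widehat T)^2\to RT_2(\widehat T)$ and $\widehat I_Q^c:C(\widehat T)\to\mathbb Q_{2,2}(\widehat T)$ commute with the divergence.
   Context: $\mathbb Q_{a,b}(\widehat T)$ denotes polynomials of degree at most $a$ in $\hat x$ and at most $b$ in $\hat y$; $RT_2(\widehat T)=\mathbb Q_{3,2}(\widehat T)\times\mathbb Q_{2,3}(\widehat T)$, so $\nabla\cdot RT_2(\widehat T)\subset\mathbb Q_{2,2}(\widehat T)$. The operator $\widehat I_{\boldsymbol V}^c$ maps $(\hat u,\hat v)$ to the unique $(\hat u_k,\hat v_k)\in RT_2(\widehat T)$ satisfying the following 24 conditions: (i) at each of the four vertices $(\hat x,\hat y)$, $\hat x=\pm1$, $\hat y=\pm1$: $\hat u_k=\hat u$, $\hat v_k=\hat v$, $\partial_{\hat x}\hat u_k=\partial_{\hat x}\hat u$, $\partial_{\hat y}\hat v_k=\partial_{\hat y}\hat v$; (ii) for $\hat x=\pm1$: $\int_{-1}^1[\hat u_k-\hat u](\hat x,\hat y)\,d\hat y=0$ and $\int_{-1}^1[\partial_{\hat x}\hat u_k-\partial_{\hat x}\hat u](\hat x,\hat y)\,d\hat y=0$; (iii) for $\hat y=\pm1$: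 $\int_{-1}^1[\hat v_k-\hat v](\hat x,\hat y)\,d\hat x=0$ and $\int_{-1}^1[\partial_{\hat y}\hat v_k-\partial_{\hat y}\hat v](\hat x,\hat y)\,d\hat x=0$. The operator $\widehat I_Q^c$ maps $\hat p\in C(\widehat T)$ to the unique $\hat p_k\in\mathbb Q_{2,2}(\widehat T)$ having the same values as $\hat p$ at the four vertices, the same mean values on the four edges, and the same mean value over $\widehat T$. *)

(* Defs.v *)
From mathcomp Require Import all_boot all_order all_algebra.
From mathcomp Require Import all_classical all_reals all_analysis.
Set Implicit Arguments.
Unset Strict Implicit.
Unset Printing Implicit Defensive.
Import Order.TTheory GRing.Theory Num.Theory.
Import numFieldTopology.Exports numFieldNormedType.Exports.
Local Open Scope classical_set_scope.
Local Open Scope ring_scope.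

Definition edge (R : realType) : set R := `[-1, 1].

Definition refsq (R : realType) : set (R * R) := @edge R `*` @edge R.

Definition pm1 (R : realType) : set R := [set -1; 1].

(* Functions on the square are represented by total functions on R * R, of
   which only the values on refsq matter.  The difference quotients below only
   involve points of refsq, so on the boundary of the square the partial
   derivatives are the one-sided ones. *)
Definition dx_quot (R : realType) (f : R * R -> R) (z : R * R) (h : R) : R :=
  (f (z.1 + h, z.2) - f z) / h.

Definition dy_quot (R : realType) (f : R * R -> R) (z : R * R) (h : R) : R :=
  (f (z.1, z.2 + h) - f z) / h.

Definition dx_nbhs (R : realType) (z : R * R) : set_system R :=
  within [set h : R | refsq (z.1 + h, z.2)] (0 : R)^'.

Definition dy_nbhs (R : realType) (z : R * R) : set_system R :=
  within [set h : R | refsq (z.1, z.2 + h)] (0 : R)^'.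

Definition dx (R : realType) (f : R * R -> R) (z : R * R) : R :=
  lim (dx_quot f z @ dx_nbhs z).

Definition dy (R : realType) (f : R * R -> R) (z : R * R) : R :=
  lim (dy_quot f z @ dy_nbhs z).

Definition C0 (R : realType) (f : R * R -> R) : Prop :=
  {within @refsq R, continuous f}.

Definition C1 (R : realType) (f : R * R -> R) : Prop :=
  [/\ C0 f,
      forall z, refsq z ->
        cvg (dx_quot f z @ dx_nbhs z) /\ cvg (dy_quot f z @ dy_nbhs z),
      C0 (dx f) & C0 (dy f)].

Definition diverg (R : realType) (w : (R * R -> R) * (R * R -> R))
  (z : R * R) : R := dx w.1 z + dy w.2 z.

(* In {poly {poly R}} the outer variable is x and the inner one is y. *)
Definition Qspace (R : realType) (a b : nat) : set (R * R -> R) :=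
  [set f | exists p : {poly {poly R}},
     [/\ (size p <= a.+1)%N, (polyXY.sizeY p <= b.+1)%N
       & forall z, f z = p.[z.1%:P].[z.2]]].

Definition RT2 (R : realType) : set ((R * R -> R) * (R * R -> R)) :=
  @Qspace R 3 2 `*` @Qspace R 2 3.

Definition edge_int (R : realType) (g : R -> R) : R :=
  Rintegral (@lebesgue_measure R) (@edge R) g.

Definition edge_mean (R : realType) (g : R -> R) : R := edge_int g / 2.

Definition sq_mean (R : realType) (f : R * R -> R) : R :=
  Rintegral (@lebesgue_measure R \x @lebesgue_measure R)%E (@refsq R) f / 4.

Definition IV_interp (R : realType) (w : (R * R -> R) * (R * R -> R)) :
    set ((R * R -> R) * (R * R -> R)) :=
  [set wk | [/\ RT2 wk,
    forall x y, pm1 x -> pm1 y ->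
      [/\ wk.1 (x, y) = w.1 (x, y), wk.2 (x, y) = w.2 (x, y),
          dx wk.1 (x, y) = dx w.1 (x, y) & dy wk.2 (x, y) = dy w.2 (x, y)],
    forall x, pm1 x ->
      edge_int (fun y => wk.1 (x, y) - w.1 (x, y)) = 0 /\
      edge_int (fun y => dx wk.1 (x, y) - dx w.1 (x, y)) = 0 &
    forall y, pm1 y ->
      edge_int (fun x => wk.2 (x, y) - w.2 (x, y)) = 0 /\
      edge_int (fun x => dy wk.2 (x, y) - dy w.2 (x, y)) = 0]].

Definition IQ_interp (R : realType) (p : R * R -> R) : set (R * R -> R) :=
  [set pk | [/\ Qspace 2 2 pk,
    forall x y, pm1 x -> pm1 y -> pk (x, y) = p (x, y),
    forall x, pm1 x ->
      edge_mean (fun y => pk (x, y)) = edge_mean (fun y => p (x, y)),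
    forall y, pm1 y ->
      edge_mean (fun x => pk (x, y)) = edge_mean (fun x => p (x, y)) &
    sq_mean pk = sq_mean p]].

(* The unique element of A (a default value if there is no such element). *)
Definition the_unique (T : pointedType) (A : set T) : T :=
  get [set t | A t /\ forall t', A t' -> t' = t].

Definition IV (R : realType) (w : (R * R -> R) * (R * R -> R)) :
  (R * R -> R) * (R * R -> R) := the_unique (IV_interp w).

Definition IQ (R : realType) (p : R * R -> R) : R * R -> R :=
  the_unique (IQ_interp p).

(* Main.v *)
Require Import Defs.
From mathcomp Require Import all_boot all_order all_algebra.
From mathcomp Require Import all_classical all_reals all_analysis.
From mathcomp Require Import polyXY measurable_realfun ring lra.

(** On the space of cubics in one variable the values and derivatives at the two
    endpoints are unisolvent (Hermite), and on quadratics so are the two endpoint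
    values and the mean.  The conditions defining either interpolant are tensor
    products of such functionals, whence existence and uniqueness.  The divergence
    of the interpolant lies in Q_{2,2}, so it remains to check that it has the
    moments of the divergence of (u, v).  The corner values and half of the edge
    integrals are among the defining conditions; the other edge integrals and the
    integral over the square reduce to them by the fundamental theorem of calculus
    and Fubini.  The second component is handled by exchanging the coordinates. *)

Set Implicit Arguments.
Unset Strict Implicit.
Unset Printing Implicit Defensive.
Import Order.TTheory GRing.Theory Num.Theory.
Import numFieldTopology.Exports numFieldNormedType.Exports.
Local Open Scope classical_set_scope.
Local Open Scope ring_scope.

(** Serves for [g] a coordinate exchange or the insertion of a line into the plane. *)
Lemma within_continuous_comp (T U V : topologicalType) (A : set T) (B : set U)
    (g : T -> U) (f : U -> V) :
  continuous g -> (forall x, A x -> B (g x)) ->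
  {within B, continuous f} -> {within A, continuous (f \o g)}.
Proof.
move=> cg AB /subspace_continuousP cf; apply/subspace_continuousP => x Ax.
move=> P /(cf _ (AB _ Ax)); rewrite /within /= /nbhs /= => PB.
have ncg : \forall t \near x, B (g t) -> P (f (g t)) := cg x _ PB.
by near=> t => At; apply: (near ncg t) => //; exact: AB.
Unshelve. all: by end_near. Qed.

(** * One-sided partial derivatives on the closed square *)

Section analysis.
Context {R : realType}.
Implicit Types (f g : R * R -> R) (z : R * R).

Lemma edgeE (x : R) : edge x = (-1 <= x <= 1) :> Prop.
Proof. by rewrite /edge /= in_itv. Qed.

Lemma pm1_edge (x : R) : pm1 x -> edge x.
Proof. by rewrite edgeE => -[->|->]; lra. Qed.

(** Exchanging the coordinates turns [dy] into [dx] (see [dyE]), so the calculus is developed for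
    [dx] alone. *)
Definition transpose f z := f (z.2, z.1).

Lemma transposeK f : transpose (transpose f) = f.
Proof. by apply/funext => -[x y]. Qed.

Lemma refsq_swap (x y : R) : refsq (y, x) = refsq (x, y).
Proof. by apply/propext; rewrite /refsq /=; tauto. Qed.

Lemma dy_quotE f z : dy_quot f z = dx_quot (transpose f) (z.2, z.1).
Proof. by apply/funext => h; case: z => [x y]. Qed.

Lemma dy_nbhsE z : dy_nbhs z = dx_nbhs (z.2, z.1).
Proof.
rewrite /dy_nbhs /dx_nbhs /=.
by under eq_fun do rewrite -refsq_swap.
Qed.

Lemma dyE f : dy f = transpose (dx (transpose f)).
Proof. by apply/funext => z; rewrite /dy dy_quotE dy_nbhsE. Qed.

Lemma C0_transpose f : C0 f -> C0 (transpose f).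
Proof.
apply: within_continuous_comp => [z|[x y]]; last by rewrite refsq_swap.
by apply: (@cvg_pair _ _ _ _ (nbhs z.2) (nbhs z.1)); [exact: cvg_snd|exact: cvg_fst].
Qed.

Lemma eq_C0 f g : (forall z, refsq z -> f z = g z) -> C0 f -> C0 g.
Proof.
by move=> fg; apply: subspace_eq_continuous => z; rewrite inE; exact: fg.
Qed.

Lemma C0_xslice f y : edge y -> C0 f -> {within @edge R, continuous (fun x => f (x, y))}.
Proof.
move=> ey; apply: (@within_continuous_comp _ _ _ _ (@refsq R) (pair^~ y) f) => // x.
by apply: (@cvg_pair _ _ _ _ (nbhs x) (nbhs y)); [exact: cvg_id|exact: cvg_cst].
Qed.

Lemma C0_yslice f x : edge x -> C0 f -> {within @edge R, continuous (fun y => f (x, y))}.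
Proof. by move=> ex /C0_transpose/(C0_xslice ex). Qed.

(** Properness makes limits along [dx_nbhs] unique, so that the [lim] in [dx] can be computed. *)
Lemma dx_nbhs_proper z : refsq z -> ProperFilter (dx_nbhs z).
Proof.
case: z => x y [/= ]; rewrite edgeE => ex ey.
apply: Build_ProperFilter_ex => P.
move=> /nbhs_ballP[e /= e0 eP].
have [h [h0 he h1]] : exists h : R, [/\ 0 < h, h < e & h <= 1].
  exists (Num.min (e / 2) 1); split.
  - by rewrite lt_min; apply/andP; split; lra.
  - by rewrite gt_min; apply/orP; left; lra.
  - by rewrite ge_min lexx orbT.
(* The increment points towards the axis x = 0, and [h <= 1] keeps the shifted point from leaving
   through the opposite side. *)
exists (if x <= 0 then h else - h); apply: eP.
- by rewrite /ball /=; case: ifP => _; rewrite sub0r ?opprK ?normrN gtr0_norm.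
- by case: ifP => _; rewrite ?oppr_eq0 gt_eqF.
- by rewrite /refsq /=; split=> //; rewrite edgeE; case: (leP x 0) => x0 /=; lra.
Qed.

Lemma dx_cvg f z d : refsq z -> dx_quot f z @ dx_nbhs z --> d -> dx f z = d.
Proof. by move=> rz; have := dx_nbhs_proper rz => PF; exact: cvg_lim. Qed.

Lemma derive_dx_quot f z :
  (fun h => h^-1 *: (((fun t => f (t, z.2)) \o shift z.1) (h *: 1) - f (z.1, z.2)))
  = dx_quot f z.
Proof.
apply/funext => h; rewrite /dx_quot /= [_%:A]mulr1 (addrC h) -surjective_pairing.
by rewrite /GRing.scale /= mulrC.
Qed.

Lemma derive_dx_cvg f z d : is_derive z.1 1 (fun x => f (x, z.2)) d ->
  dx_quot f z @ dx_nbhs z --> d.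
Proof.
move=> [+ <-]; rewrite /derivable /derive derive_dx_quot.
exact: cvg_within_filter.
Qed.

(** Away from the sides x = -1 and x = 1 every small increment is admissible. Hence [dx] is an
    ordinary derivative there, as the fundamental theorem of calculus requires. *)
Lemma dnbhs_dx_nbhs x y : -1 < x < 1 -> edge y ->
  (0 : R)^' `=>` dx_nbhs (x, y).
Proof.
move=> x1 ey P nP.
have {}nP : \forall h \near (0 : R)^', refsq (x + h, y) -> P h := nP.
have e0 : 0 < Num.min (1 - x) (1 + x).
  by rewrite lt_min; apply/andP; split; lra.
near=> h; suff rh : refsq (x + h, y) by apply: (near nP h).
split => //=; rewrite edgeE.
have : `|h| < Num.min (1 - x) (1 + x) by near: h; exact: dnbhs0_lt.
by rewrite lt_min; have := ler_norm h; have := ler_norm (- h); rewrite normrN; lra.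
Unshelve. all: by end_near. Qed.

Lemma dx_derive f x y : -1 < x < 1 -> edge y ->
  cvg (dx_quot f (x, y) @ dx_nbhs (x, y)) ->
  is_derive x 1 (fun t => f (t, y)) (dx f (x, y)).
Proof.
move=> x1 ey cf.
have cf0 : dx_quot f (x, y) @ 0^' --> dx f (x, y).
  by apply: cvg_trans cf; apply: cvg_app; exact: dnbhs_dx_nbhs.
split; rewrite ?/derivable ?/derive (derive_dx_quot f (x, y)); first exact: (cvgP _ cf0).
exact: cvg_lim cf0.
Qed.

End analysis.

(** * Integration over the edges and over the square *)

Section integrals.
Context {R : realType}.
Implicit Types (f g : R * R -> R) (z : R * R).
Local Notation mu := (@lebesgue_measure R).

(** The part of [C1] that concerns x; for the second component of a field it is imposed on the
    transpose. *)
Definition C1x f := [/\ C0 f,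
  forall z, refsq z -> cvg (dx_quot f z @ dx_nbhs z) & C0 (dx f)].

Lemma C1_C1x f : C1 f -> C1x f.
Proof. by move=> [cf cdf cx _]; split=> // z /cdf[]. Qed.

Lemma C1_C1x_transpose f : C1 f -> C1x (transpose f).
Proof.
move=> [cf cdf _ cy]; split=> [|[x y]|]; first exact: C0_transpose.
- by rewrite -refsq_swap => /cdf[_]; rewrite dy_quotE dy_nbhsE.
- by rewrite -[dx _]transposeK -dyE; exact: C0_transpose.
Qed.

(** Fundamental theorem of calculus on a horizontal segment: the ordinary derivative is taken in the
    open segment, and continuity of the slice covers the endpoints. *)
Lemma edge_int_dx f y : C1x f -> edge y ->
  edge_int (fun x => dx f (x, y)) = f (1, y) - f (-1, y).
Proof.
move=> [cf df cdf] ey; have lt11 : -1 < 1 :> R by lra.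
have dF (x : R) : -1 < x < 1 -> is_derive x 1 (fun t => f (t, y)) (dx f (x, y)).
  move=> x1; apply: dx_derive => //; apply: df; split=> //=.
  by rewrite edgeE; lra.
rewrite /edge_int /Rintegral /edge.
rewrite (@continuous_FTC2 _ _ (fun x => f (x, y)) _ _ lt11) //.
- exact: C0_xslice.
- have /(continuous_within_itvP _ lt11)[_ ? ?] := C0_xslice ey cf.
  by split => // x; rewrite in_itv /= => /dF[].
- by move=> x; rewrite in_itv /= => /dF xd; rewrite derive1E derive_val.
Qed.

Lemma edge_integrable (g : R -> R) : {within @edge R, continuous g} ->
  mu.-integrable (@edge R) (EFin \o g).
Proof. by apply: continuous_compact_integrable; exact: segment_compact. Qed.

Lemma measurable_edge : measurable (@edge R).
Proof. exact: measurable_itv. Qed.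

Lemma edge_intD (g h : R -> R) : {within @edge R, continuous g} ->
  {within @edge R, continuous h} ->
  edge_int (fun x => g x + h x) = edge_int g + edge_int h.
Proof.
by move=> cg ch; apply: RintegralD; [exact: measurable_edge|exact: edge_integrable..].
Qed.

Lemma edge_intB (g h : R -> R) : {within @edge R, continuous g} ->
  {within @edge R, continuous h} ->
  edge_int (fun x => g x - h x) = edge_int g - edge_int h.
Proof.
by move=> cg ch; apply: RintegralB; [exact: measurable_edge|exact: edge_integrable..].
Qed.

Lemma eq_edge_int (g h : R -> R) : (forall x, edge x -> g x = h x) ->
  edge_int g = edge_int h.
Proof. by move=> gh; apply: eq_Rintegral => x; rewrite inE; exact: gh. Qed.

(** Continuity refers to the product topology, integration to the product sigma-algebra, generated
    by rectangles. The two meet because an open set is the union of the countably many rational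
    squares that it contains. *)
Lemma open_measurable_prod (U : set (R * R)) : open U -> measurable U.
Proof.
move=> oU.
pose B (i : rat * rat * rat) : set (R * R) :=
  ball (ratr i.1.1 : R) (ratr i.2) `*` ball (ratr i.1.2 : R) (ratr i.2).
pose F i := if `[< B i `<=` U >] then B i else set0.
suff -> : U = \bigcup_i F i.
  apply: countable_bigcupT_measurable; first exact: countableP.
  move=> i; rewrite /F; case: ifP => // _.
  by apply: measurableX; exact: measurable_ball.
apply/seteqP; split => [[x y] Uxy|z [i _]]; last first.
  by rewrite /F; case: ifPn => // /asboolP; exact.
move: oU; rewrite openE => /(_ _ Uxy) /nbhs_ballP[e /= e0 eU].
(* With a radius below [e / 2] and a centre within one radius of [(x, y)], every point of the
   rational square is within [e] of [(x, y)]. *)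
have [d] := @rat_in_itvoo R 0 (e / 2) ltac:(lra).
rewrite in_itv /= => /andP[d0 de].
have [p] := @rat_in_itvoo R x (x + ratr d) ltac:(lra).
rewrite in_itv /= => px.
have [q] := @rat_in_itvoo R y (y + ratr d) ltac:(lra).
rewrite in_itv /= => qy.
have inB : B (p, q, d) (x, y).
  by split; rewrite /ball /= ltr_norml; lra.
exists (p, q, d) => //; rewrite /F; case: ifPn => // /asboolP; case => -[x' y'] [].
rewrite /ball /= !ltr_norml => hx hy; apply: eU.
by split; rewrite /ball /= ltr_norml; lra.
Qed.

Lemma measurable_refsq : measurable (@refsq R).
Proof. by apply: measurableX; exact: measurable_edge. Qed.

Lemma C0_measurable f : C0 f -> measurable_fun (@refsq R) f.
Proof.
move=> /continuousP cf; apply: (measurability _ (RGenOpens.measurableE R)).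
move=> _ [_ [a [b ->] <-]].
have /cf/open_subspaceP[V oV VD] : open `]a, b[%classic by exact: interval_open.
rewrite setIC -VD.
by apply: measurableI; [exact: open_measurable_prod|exact: measurable_refsq].
Qed.

(** A continuous function is bounded on the compact square, which has finite measure. *)
Lemma C0_integrable f : C0 f ->
  (mu \x mu)%E.-integrable (@refsq R) (EFin \o f).
Proof.
move=> cf; apply: measurable_bounded_integrable.
- exact: measurable_refsq.
- suff fin : ((mu \x mu)%E (@edge R `*` @edge R) < +oo)%E by exact: fin.
  rewrite product_measure1E; [|exact: measurable_edge..].
  have fe : (mu (@edge R) < +oo)%E.
    by apply: compact_finite_measure; exact: segment_compact.
  by apply: lte_mul_pinfty => //; rewrite ge0_fin_numE.
- exact: C0_measurable.
- have : compact (f @` @refsq R).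
    apply: continuous_compact => //.
    by apply: compact_setX; exact: segment_compact.
  move=> /compact_bounded[M [Mr hM]]; exists M; split=> // r Mr' z rz.
  by apply: hM => //; exists z.
Qed.

(** Fubini is applied on the whole plane to the extension of [f] by zero; integrating a horizontal
    section of it gives the edge integral, itself extended by zero. *)
Lemma slice_integral f y : C0 f ->
  (\int[mu]_x ((EFin \o f) \_ (@refsq R)) (x, y) =
  ((EFin \o (fun y => edge_int (fun x => f (x, y)))) \_ (@edge R)) y)%E.
Proof.
move=> cf; rewrite patchE; case: ifPn => [|]; rewrite ?notin_setE ?inE => ey.
  rewrite /= /edge_int fineK; last first.
    apply: integrable_fin_num; first exact: measurable_edge.
    exact/edge_integrable/C0_xslice.
  rewrite [RHS]integral_mkcond; apply: eq_integral => x _; rewrite /= !patchE.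
  by congr (if _ then _ else _); apply/idP/idP; rewrite !inE /refsq /=; [case|].
rewrite integral0_eq // => x _; rewrite /= patchE memNset // => -[_].
exact: ey.
Qed.

Lemma sq_int_yx f : C0 f ->
  Rintegral (mu \x mu)%E (@refsq R) f =
  edge_int (fun y => edge_int (fun x => f (x, y))).
Proof.
move=> cf; have := C0_integrable cf.
rewrite integrable_mkcond; last exact: measurable_refsq.
move=> /integral21_prod_meas1 fub; rewrite [RHS]/edge_int /Rintegral.
rewrite integral_mkcond -fub [in RHS]integral_mkcond; congr fine.
by apply: eq_integral => y _; exact: slice_integral.
Qed.

Lemma sq_int_xy f : C0 f ->
  Rintegral (mu \x mu)%E (@refsq R) f =
  edge_int (fun x => edge_int (fun y => f (x, y))).
Proof.
move=> cf; have := C0_integrable cf.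
rewrite integrable_mkcond; last exact: measurable_refsq.
move=> /integral12_prod_meas1 fub; rewrite [RHS]/edge_int /Rintegral.
rewrite integral_mkcond -fub [in RHS]integral_mkcond; congr fine.
apply: eq_integral => x _.
(* Vertical sections of [f] are horizontal sections of its transpose. *)
rewrite -[RHS](slice_integral x (C0_transpose cf)); apply: eq_integral => y _.
rewrite !patchE; congr (if _ then _ else _).
by apply/idP/idP; rewrite !inE refsq_swap.
Qed.

End integrals.

(** * Bivariate polynomials and unisolvence in one variable *)

Section polynomials.
Context {R : realType}.
Implicit Types (f g : R * R -> R) (p q : {poly R}) (P : {poly {poly R}}).

Definition eval2 P : R * R -> R := fun z => P.[z.1%:P].[z.2].

Lemma sizeY_leP P n : reflect (forall i, (size (P`_i)%R <= n)%N) (sizeY P <= n)%N.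
Proof.
apply: (iffP idP) => [Pn i|Pn]; first exact: leq_trans (max_size_coefXY _ _) Pn.
by apply/bigmax_leqP => i _; exact: Pn.
Qed.

Lemma QspaceP a b f : Qspace a b f <-> exists P,
  [/\ (size P <= a.+1)%N, (sizeY P <= b.+1)%N & f = eval2 P].
Proof.
by split => -[P [sP sYP fP]]; exists P; split => //;
  [exact/funext | move=> z; rewrite fP].
Qed.

Lemma Qspace_transpose a b f : Qspace a b f -> Qspace b a (transpose f).
Proof.
move=> /QspaceP[P [sP sYP ->]]; exists (swapXY P); split.
- by rewrite -sizeYE.
- by rewrite sizeYE swapXYK.
- by move=> z; rewrite /transpose /eval2 horner2_swapXY.
Qed.

Lemma QspaceD a b f g : Qspace a b f -> Qspace a b g -> Qspace a b (f \+ g).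
Proof.
move=> [P [sP /sizeY_leP sYP fP]] [Q [sQ /sizeY_leP sYQ gQ]]; exists (P + Q); split.
- by rewrite (leq_trans (size_polyD _ _)) // geq_max sP.
- apply/sizeY_leP => i; rewrite coefD.
  by rewrite (leq_trans (size_polyD _ _)) // geq_max sYP sYQ.
- by move=> z; rewrite !hornerD -fP -gQ.
Qed.

Lemma Qspace_tensor a b p q : (size p <= a.+1)%N -> (size q <= b.+1)%N ->
  Qspace a b (fun z => p.[z.1] * q.[z.2]).
Proof.
move=> sp sq; exists (q *: p^:P); split.
- by rewrite (leq_trans (size_scale_leq _ _)) // size_map_polyC.
- apply/sizeY_leP => i; rewrite coefZ coef_map /= mulrC mul_polyC.
  exact: leq_trans (size_scale_leq _ _) sq.
- by move=> z; rewrite hornerZ horner_map /= hornerM hornerC mulrC.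
Qed.

Lemma eval2_continuous P : continuous (eval2 P).
Proof.
elim/poly_ind: P => [|P c IH] z.
  have -> : eval2 0 = cst 0 by apply/funext => t; rewrite /eval2 !horner0.
  exact: cvg_cst.
have -> : eval2 (P * 'X + c%:P) = (fun t => eval2 P t * t.1 + c.[t.2]).
  by apply/funext => t; rewrite /eval2 !hornerE.
apply: cvgD; first by apply: cvgM; [exact: IH|exact: cvg_fst].
apply: (@cvg_comp _ _ _ snd (horner c)); first exact: cvg_snd.
exact: continuous_horner.
Qed.

(** Freezing y evaluates the coefficients and leaves a polynomial in x; freezing x is written
    [P.[x%:P]] and leaves a polynomial in y. *)
Definition xslice P (y : R) : {poly R} := map_poly (horner_eval y) P.

Lemma eval2_xslice P x y : eval2 P (x, y) = (xslice P y).[x].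
Proof.
by rewrite /xslice -[x in RHS](hornerC x y) (horner_map (horner_eval y)).
Qed.

Lemma eval2_xsection P y : (fun x => eval2 P (x, y)) = horner (xslice P y).
Proof. by apply/funext => x; rewrite eval2_xslice. Qed.

Lemma deriv_xslice P y : (xslice P y)^`() = xslice P^`() y.
Proof. exact: deriv_map. Qed.

Lemma dx_eval2_cvg P z : dx_quot (eval2 P) z @ dx_nbhs z --> eval2 P^`() z.
Proof.
apply: derive_dx_cvg; case: z => x y /=.
rewrite eval2_xslice -deriv_xslice eval2_xsection.
exact: is_derive_poly.
Qed.

Lemma dx_eval2 P z : refsq z -> dx (eval2 P) z = eval2 P^`() z.
Proof. by move=> rz; apply: dx_cvg => //; exact: dx_eval2_cvg. Qed.

Lemma C0_eval2 P : C0 (eval2 P).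
Proof. exact/continuous_subspaceT/eval2_continuous. Qed.

Lemma C1x_eval2 P : C1x (eval2 P).
Proof.
split; first exact: C0_eval2.
- by move=> z _; apply: cvgP; exact: dx_eval2_cvg.
- by apply: (@eq_C0 _ (eval2 P^`())) => [z rz|]; [rewrite dx_eval2|exact: C0_eval2].
Qed.

Lemma sizeY_deriv P n : (sizeY P <= n)%N -> (sizeY P^`() <= n)%N.
Proof.
move=> /sizeY_leP Pn; apply/sizeY_leP => i; rewrite coef_deriv.
by rewrite -scaler_nat (leq_trans (size_scale_leq _ _)).
Qed.

Lemma size_deriv_leq (S : nzRingType) (r : {poly S}) n :
  (size r <= n.+1)%N -> (size r^`() <= n)%N.
Proof.
have [->|r0] := eqVneq r 0; first by rewrite linear0 size_poly0.
by move=> rn; rewrite -ltnS (leq_trans (lt_size_deriv r0)).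
Qed.

Lemma edge_int_deriv p : edge_int (horner p^`()) = p.[1] - p.[-1].
Proof.
have lt11 : -1 < 1 :> R by lra.
have ch (r : {poly R}) : {within @edge R, continuous (horner r)}.
  exact/continuous_subspaceT/continuous_horner.
rewrite /edge_int /Rintegral /edge (@continuous_FTC2 _ _ (horner p) _ _ lt11) //.
  have /(continuous_within_itvP _ lt11)[_ ? ?] := ch p.
  by split => // x _; exact: derivable_horner.
by move=> x _; rewrite derivE.
Qed.

Lemma horner3 p x : (size p <= 3)%N -> p.[x] = p`_0 + p`_1 * x + p`_2 * x ^+ 2.
Proof.
by move=> sp; rewrite (horner_coef_wide _ sp) !big_ord_recl big_ord0 /=; ring.
Qed.

Lemma horner4 p x : (size p <= 4)%N ->
  p.[x] = p`_0 + p`_1 * x + p`_2 * x ^+ 2 + p`_3 * x ^+ 3.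
Proof.
by move=> sp; rewrite (horner_coef_wide _ sp) !big_ord_recl big_ord0 /=; ring.
Qed.

Lemma edge_int_horner p : (size p <= 3)%N ->
  edge_int (horner p) = 2 * p`_0 + 2 / 3 * p`_2.
Proof.
(* [F] is the antiderivative of [p] that vanishes at 0; its quadratic term takes equal values at
   both endpoints and cancels. *)
move=> sp; pose F : {poly R} := Poly [:: 0; p`_0; p`_1 / 2; p`_2 / 3].
have sF : (size F <= 4)%N by exact: size_Poly.
have sF' : (size F^`() <= 3)%N by exact: size_deriv_leq.
have -> : horner p = horner F^`().
  by apply/funext => x; rewrite !horner3 // !coef_deriv !coef_Poly /=; field.
by rewrite edge_int_deriv !horner4 // !coef_Poly /=; field.
Qed.

(** The endpoint values give the linear coefficient and the sum of the two even ones; the integral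
    weighs the latter by 2 and 2/3 and so separates them. *)
Lemma eq_horner3 p q : (size p <= 3)%N -> (size q <= 3)%N ->
  p.[1] = q.[1] -> p.[-1] = q.[-1] -> edge_int (horner p) = edge_int (horner q) ->
  p = q.
Proof.
move=> sp sq; rewrite !edge_int_horner // !horner3 // => e1 e2 e3.
apply/polyP => -[|[|[|i]]]; [lra|lra|lra|].
by rewrite !nth_default // (leq_trans sp, leq_trans sq).
Qed.

(** Sums and differences over the two endpoints split the four equations into one regular system for
    the even coefficients and one for the odd ones. *)
Lemma eq_horner4 p q : (size p <= 4)%N -> (size q <= 4)%N ->
  p.[1] = q.[1] -> p.[-1] = q.[-1] ->
  p^`().[1] = q^`().[1] -> p^`().[-1] = q^`().[-1] -> p = q.
Proof.
move=> sp sq; have sp' := size_deriv_leq sp; have sq' := size_deriv_leq sq.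
rewrite !(horner4 _ sp) !(horner4 _ sq) !horner3 // !coef_deriv => e1 e2 e3 e4.
apply/polyP => -[|[|[|[|i]]]]; [lra|lra|lra|lra|].
by rewrite !nth_default // (leq_trans sp, leq_trans sq).
Qed.

End polynomials.

(** * The interpolants and their moments *)

Section interpolation.
Context {R : realType}.
Implicit Types (u f g p : R * R -> R) (P : {poly {poly R}}).
Local Notation mu := (@lebesgue_measure R).

Lemma the_uniqueE (T : pointedType) (A : set T) t :
  A t -> (forall t', A t' -> t' = t) -> the_unique A = t.
Proof. by move=> At Au; apply: get_unique => // t' [/Au]. Qed.

Lemma eval2_pair P x y : eval2 P (x, y) = P.[x%:P].[y].
Proof. by []. Qed.

(** The quadratic with the endpoint values and the integral of [g], found by solving for its
    coefficients. *)
Definition mean_interp (g : R -> R) : {poly R} :=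
  Poly [:: 3 / 4 * edge_int g - (g 1 + g (-1)) / 4; (g 1 - g (-1)) / 2;
           3 / 4 * (g 1 + g (-1)) - 3 / 4 * edge_int g].

Lemma size_mean_interp (g : R -> R) : (size (mean_interp g) <= 3)%N.
Proof. exact: size_Poly. Qed.

Lemma mean_interp_pm1 (g : R -> R) x : pm1 x -> (mean_interp g).[x] = g x.
Proof.
by move=> [->|->]; rewrite horner3 ?size_mean_interp // !coef_Poly /=; field.
Qed.

Lemma edge_int_mean_interp (g : R -> R) : edge_int (horner (mean_interp g)) = edge_int g.
Proof. by rewrite edge_int_horner ?size_mean_interp // !coef_Poly /=; field. Qed.

(** The Hermite cubic with values [a], [b] and slopes [c], [d] at 1 and -1, in this order. *)
Definition hermite (a b c d : R) : {poly R} :=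
  Poly [:: (2 * a + 2 * b - c + d) / 4; (3 * a - 3 * b - c - d) / 4;
           (c - d) / 4; (- a + b + c + d) / 4].

Lemma size_hermite a b c d : (size (hermite a b c d) <= 4)%N.
Proof. exact: size_Poly. Qed.

Lemma hermiteE a b c d :
  [/\ (hermite a b c d).[1] = a, (hermite a b c d).[-1] = b,
      (hermite a b c d)^`().[1] = c & (hermite a b c d)^`().[-1] = d].
Proof.
have sH := size_hermite a b c d; have sH' := size_deriv_leq sH.
by split; rewrite ?(horner4 _ sH) ?(horner3 _ sH')
  ?coef_deriv /hermite !coef_Poly /=; field.
Qed.

(** Linearity in the data later exhibits the interpolant as a sum of four tensor products. *)
Lemma hermite_sum a b c d x : (hermite a b c d).[x] =
  (hermite 1 0 0 0).[x] * a + (hermite 0 1 0 0).[x] * b +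
  ((hermite 0 0 1 0).[x] * c + (hermite 0 0 0 1).[x] * d).
Proof. by rewrite !horner4 ?size_hermite // !coef_Poly /=; field. Qed.

(** The twelve conditions on the first component. Comparing two integrals, rather than integrating a
    difference, makes existence and uniqueness hold for an arbitrary [u]; [xinterpP] relates the two
    forms under continuity. *)
Definition xinterp u f := [/\ Qspace 3 2 f,
  forall x y, pm1 x -> pm1 y ->
    f (x, y) = u (x, y) /\ dx f (x, y) = dx u (x, y) &
  forall x, pm1 x ->
    edge_int (fun y => f (x, y)) = edge_int (fun y => u (x, y)) /\
    edge_int (fun y => dx f (x, y)) = edge_int (fun y => dx u (x, y))].

Lemma dx_horner f q x y : refsq (x, y) -> (forall t, f (t, y) = q.[t]) ->
  dx f (x, y) = q^`().[x].
Proof.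
move=> rxy fq; apply: dx_cvg => //; apply: derive_dx_cvg => /=.
have -> : (fun t => f (t, y)) = horner q by apply/funext.
exact: is_derive_poly.
Qed.

(** The values and the x-derivatives on the sides x = 1 and x = -1 are interpolated by quadratics in
    y; for each y a Hermite cubic in x joins them. *)
Lemma xinterp_exists u : exists f, xinterp u f.
Proof.
pose U x := mean_interp (fun y => u (x, y)).
pose D x := mean_interp (fun y => dx u (x, y)).
pose H y := hermite (U 1).[y] (U (-1)).[y] (D 1).[y] (D (-1)).[y].
pose f (z : R * R) := (H z.2).[z.1].
have fU x y : pm1 x -> f (x, y) = (U x).[y].
  have [h1 h2 _ _] := hermiteE (U 1).[y] (U (-1)).[y] (D 1).[y] (D (-1)).[y].
  by case=> ->.
have fD x y : pm1 x -> edge y -> dx f (x, y) = (D x).[y].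
  move=> xp ye; rewrite (@dx_horner f (H y)) //; last by split => //; exact: pm1_edge.
  have [_ _ h1 h2] := hermiteE (U 1).[y] (U (-1)).[y] (D 1).[y] (D (-1)).[y].
  by case: xp => ->.
exists f; split.
- rewrite [f](_ : _ =
    ((fun z => (hermite 1 0 0 0).[z.1] * (U 1).[z.2]) \+
     (fun z => (hermite 0 1 0 0).[z.1] * (U (-1)).[z.2])) \+
    ((fun z => (hermite 0 0 1 0).[z.1] * (D 1).[z.2]) \+
     (fun z => (hermite 0 0 0 1).[z.1] * (D (-1)).[z.2]))); last first.
    by apply/funext => z; rewrite /f hermite_sum.
  by do 2![apply: QspaceD]; apply: Qspace_tensor; rewrite ?size_hermite ?size_mean_interp.
- by move=> x y xp yp; rewrite fU // fD ?mean_interp_pm1 //; exact: pm1_edge.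
- move=> x xp; split.
    by under eq_fun do rewrite fU //; exact: edge_int_mean_interp.
  by rewrite (eq_edge_int (fun y => fD x y xp)); exact: edge_int_mean_interp.
Qed.

Lemma pm1_1 : pm1 (1 : R). Proof. by right. Qed.
Lemma pm1_N1 : pm1 (-1 : R). Proof. by left. Qed.

Lemma eq_ysection P Q x : pm1 x -> (sizeY P <= 3)%N -> (sizeY Q <= 3)%N ->
  (forall y, pm1 y -> eval2 P (x, y) = eval2 Q (x, y)) ->
  edge_int (fun y => eval2 P (x, y)) = edge_int (fun y => eval2 Q (x, y)) ->
  P.[x%:P] = Q.[x%:P].
Proof.
move=> xp sP sQ PQ ePQ; apply: eq_horner3 => //.
- exact: leq_trans (max_size_evalC _ _) sP.
- exact: leq_trans (max_size_evalC _ _) sQ.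
- exact: PQ pm1_1.
- exact: PQ pm1_N1.
Qed.

Lemma size_xslice P n y : (size P <= n)%N -> (size (xslice P y) <= n)%N.
Proof. exact/leq_trans/size_poly. Qed.

(** On the sides x = 1 and x = -1 the traces of [f] and [g], and those of their x-derivatives, are
    quadratics in y with the same data. So for every real y the x-slices are cubics with the same
    Hermite data, which gives equality on the whole plane. *)
Lemma xinterp_unique u f g : xinterp u f -> xinterp u g -> f = g.
Proof.
move=> [/QspaceP[P [sP sYP ->]] vP eP] [/QspaceP[Q [sQ sYQ ->]] vQ eQ].
have PQ x : pm1 x -> P.[x%:P] = Q.[x%:P].
  move=> xp; apply: eq_ysection => // [y yp|].
  - by have [[-> _] [-> _]] := (vP x y xp yp, vQ x y xp yp).
  - by have [[-> _] [-> _]] := (eP x xp, eQ x xp).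
have dxS S x : pm1 x -> edge_int (fun y => eval2 S^`() (x, y)) =
    edge_int (fun y => dx (eval2 S) (x, y)).
  move=> xp; apply: eq_edge_int => y ye; rewrite dx_eval2 //.
  by split => //; exact: pm1_edge.
have PQ' x : pm1 x -> P^`().[x%:P] = Q^`().[x%:P].
  move=> xp; apply: eq_ysection => //; try exact: sizeY_deriv; [move=> y yp|].
    rewrite -!dx_eval2; [|by split; exact: pm1_edge..].
    by have [[_ ->] [_ ->]] := (vP x y xp yp, vQ x y xp yp).
  by rewrite !dxS //; have [[_ ->] [_ ->]] := (eP x xp, eQ x xp).
apply/funext => -[x y]; rewrite !eval2_xslice; congr _.[_].
have [p1 m1] := (pm1_1, pm1_N1).
apply: eq_horner4; rewrite ?size_xslice // ?deriv_xslice -!eval2_xslice !eval2_pair.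
- by rewrite PQ.
- by rewrite PQ.
- by rewrite PQ'.
- by rewrite PQ'.
Qed.

Definition sq_int f := Rintegral (mu \x mu)%E (@refsq R) f.

Definition same_moments f g := [/\
  forall x y, pm1 x -> pm1 y -> f (x, y) = g (x, y),
  forall x, pm1 x -> edge_int (fun y => f (x, y)) = edge_int (fun y => g (x, y)),
  forall y, pm1 y -> edge_int (fun x => f (x, y)) = edge_int (fun x => g (x, y)) &
  sq_int f = sq_int g].

Lemma IQ_interpP p f : IQ_interp p f <-> Qspace 2 2 f /\ same_moments f p.
Proof.
have two0 : (2 : R)^-1 != 0 by rewrite invr_eq0 pnatr_eq0.
have four0 : (4 : R)^-1 != 0 by rewrite invr_eq0 pnatr_eq0.
split=> [[Qf v ex ey sq]|[Qf [v ex ey sq]]].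
  split=> //; split=> // [x xp|y yp|].
  - exact: (mulIf two0) (ex x xp).
  - exact: (mulIf two0) (ey y yp).
  - exact: (mulIf four0) sq.
split=> // [x xp|y yp|].
- by rewrite /edge_mean ex.
- by rewrite /edge_mean ey.
- by rewrite /sq_mean -/(sq_int f) sq.
Qed.

(** The two orders of iterated integration give the same integral. *)
Lemma sq_int_transpose f : C0 f -> sq_int (transpose f) = sq_int f.
Proof. by move=> cf; rewrite /sq_int sq_int_xy ?sq_int_yx //; exact: C0_transpose. Qed.

Lemma same_moments_transpose f g : C0 f -> C0 g ->
  same_moments f g -> same_moments (transpose f) (transpose g).
Proof.
move=> cf cg [v ex ey sq]; split=> // [x y xp yp|]; first exact: v.
by rewrite !sq_int_transpose.
Qed.

Lemma sq_intD f g : C0 f -> C0 g -> sq_int (f \+ g) = sq_int f + sq_int g.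
Proof.
by move=> cf cg; apply: RintegralD; [exact: measurable_refsq|exact: C0_integrable..].
Qed.

Lemma same_momentsD f f' g g' : C0 f -> C0 f' -> C0 g -> C0 g' ->
  same_moments f g -> same_moments f' g' -> same_moments (f \+ f') (g \+ g').
Proof.
move=> cf cf' cg cg' [v ex ey sq] [v' ex' ey' sq']; split=> [x y xp yp|x xp|y yp|].
- by rewrite /= v // v'.
- have xe := pm1_edge xp; rewrite /= !edge_intD; [|exact: C0_yslice..].
  by rewrite ex // ex'.
- have ye := pm1_edge yp; rewrite /= !edge_intD; [|exact: C0_xslice..].
  by rewrite ey // ey'.
- by rewrite !sq_intD // sq sq'.
Qed.

(** First the traces on the two vertical sides agree, then the integrals over x at each height y.
    Each x-slice is then a quadratic with known endpoint values and integral. *)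
Lemma same_moments_unique f g p : Qspace 2 2 f -> Qspace 2 2 g ->
  same_moments f p -> same_moments g p -> f = g.
Proof.
move=> /QspaceP[P [sP sYP ->]] /QspaceP[Q [sQ sYQ ->]] [v ex ey sq] [v' ex' ey' sq'].
have PQ x : pm1 x -> P.[x%:P] = Q.[x%:P].
  move=> xp; apply: eq_ysection => // [y yp|]; first by rewrite v // v'.
  by rewrite ex // ex'.
(* [J S] is the integral of [S] over x, a polynomial in y, by the formula of [edge_int_horner]. Its
   endpoint values are integrals over horizontal edges, and its own integral is that over the
   square. *)
pose J (S : {poly {poly R}}) : {poly R} := 2 *: S`_0 + (2 / 3) *: S`_2.
have sJ S : (sizeY S <= 3)%N -> (size (J S) <= 3)%N.
  move=> /sizeY_leP sS; rewrite (leq_trans (size_polyD _ _)) // geq_max.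
  by rewrite !(leq_trans (size_scale_leq _ _)).
have JE (S : {poly {poly R}}) y : (size S <= 3)%N ->
    edge_int (fun x => eval2 S (x, y)) = (J S).[y].
  move=> sS; rewrite eval2_xsection edge_int_horner ?size_xslice // !coef_map /=.
  by rewrite /horner_eval /J !hornerE.
have JPQ : J P = J Q.
  apply: eq_horner3; rewrite ?sJ //.
  - by rewrite -!JE // (ey _ pm1_1) (ey' _ pm1_1).
  - by rewrite -!JE // (ey _ pm1_N1) (ey' _ pm1_N1).
  - rewrite (eq_edge_int (fun y _ => esym (JE P y sP))).
    rewrite (eq_edge_int (fun y _ => esym (JE Q y sQ))).
    by rewrite -!sq_int_yx; [exact: etrans sq (esym sq')|exact: C0_eval2..].
apply/funext => -[x y]; rewrite !eval2_xslice; congr _.[_].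
have [p1 m1] := (pm1_1, pm1_N1).
apply: eq_horner3; rewrite ?size_xslice // -?eval2_xslice ?eval2_pair ?PQ //.
have := JE P y sP; have := JE Q y sQ; rewrite JPQ.
by rewrite !eval2_xsection => -> ->.
Qed.

(** Corners and vertical edges are defining conditions. On a horizontal edge the integral of the
    derivative is a difference of corner values; over the square, integrating in x first leaves a
    difference of integrals of the function over the two vertical edges. *)
Lemma xinterp_same_moments u P : C1x u -> xinterp u (eval2 P) ->
  same_moments (eval2 P^`()) (dx u).
Proof.
move=> cu [_ v e]; have cP := C1x_eval2 P; have [p1 m1] := (pm1_1, pm1_N1).
have dP x y : edge x -> edge y -> eval2 P^`() (x, y) = dx (eval2 P) (x, y).
  by move=> xe ye; rewrite dx_eval2.
split=> [x y xp yp|x xp|y yp|].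
- by rewrite dP; [have [] := v x y xp yp|exact: pm1_edge..].
- have [_ <-] := e x xp; apply: eq_edge_int => y; apply: dP; exact: pm1_edge.
- have ye := pm1_edge yp; rewrite edge_int_dx //.
  rewrite (eq_edge_int (fun x xe => dP x y xe ye)) edge_int_dx //.
  by have [[-> _] [-> _]] := (v 1 y p1 yp, v (-1) y m1 yp).
- have [e1 e1'] := (pm1_edge p1, pm1_edge m1).
  have [cu0 _ cdu] := cu; have [cP0 _ _] := cP.
  rewrite /sq_int !sq_int_yx //; last exact: C0_eval2.
  rewrite (eq_edge_int (fun y ye => edge_int_dx cu ye)).
  have intP y : edge y -> edge_int (fun x => eval2 P^`() (x, y)) =
      eval2 P (1, y) - eval2 P (-1, y).
    by move=> ye; rewrite (eq_edge_int (fun x xe => dP x y xe ye)) edge_int_dx.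
  rewrite (eq_edge_int intP) !edge_intB; [|exact: C0_yslice..].
  by have [[-> _] [-> _]] := (e 1 p1, e (-1) m1).
Qed.

Lemma edge_intB_eq0 f g x : C0 f -> C0 g -> edge x ->
  edge_int (fun y => f (x, y) - g (x, y)) = 0 <->
  edge_int (fun y => f (x, y)) = edge_int (fun y => g (x, y)).
Proof.
move=> cf cg xe; rewrite edge_intB; [|exact: C0_yslice..].
by split=> [/subr0_eq|->]; rewrite ?subrr.
Qed.

Lemma xinterpP u f : C1x u -> xinterp u f <-> [/\ Qspace 3 2 f,
  forall x y, pm1 x -> pm1 y ->
    f (x, y) = u (x, y) /\ dx f (x, y) = dx u (x, y) &
  forall x, pm1 x -> edge_int (fun y => f (x, y) - u (x, y)) = 0 /\
    edge_int (fun y => dx f (x, y) - dx u (x, y)) = 0].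
Proof.
move=> [cu _ cdu]; split => -[Qf v e]; split=> // x xp; have xe := pm1_edge xp;
  have [e1 e2] := e x xp; have [P [_ _ fP]] := (QspaceP _ _ _).1 Qf;
  have [cf _ cdf] := C1x_eval2 P; rewrite -fP in cf cdf.
  by split; apply/edge_intB_eq0.
by split; apply/edge_intB_eq0.
Qed.

(** The 24 conditions decouple into twelve for each component, those for the second being the first
    twelve with the coordinates exchanged. *)
Lemma IV_interpP u v w : C1 u -> C1 v ->
  IV_interp (u, v) w <-> xinterp u w.1 /\ xinterp (transpose v) (transpose w.2).
Proof.
move=> /C1_C1x/xinterpP cu /C1_C1x_transpose/xinterpP cv; rewrite cu cv /IV_interp /=.
rewrite !dyE; split=> [[[Qf Qg] vx ex ey]|[[Qf vx ex] [Qg vy ey]]].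
  split; split=> //.
  - move=> x y xp yp; by have [] := vx x y xp yp.
  - exact: Qspace_transpose.
  - move=> y x yp xp; by have [] := vx x y xp yp.
split=> //; first by split=> //=; rewrite -[w.2]transposeK; exact: Qspace_transpose.
by move=> x y xp yp; have [] := vx x y xp yp; have [] := vy y x yp xp.
Qed.

End interpolation.

Theorem lemma1 (R : realType) (u v : R * R -> R) (hu : C1 u) (hv : C1 v) :
  forall z : R * R, refsq z -> diverg (IV (u, v)) z = IQ (diverg (u, v)) z.
Proof.
have [cu cv] := (C1_C1x hu, C1_C1x_transpose hv).
have [f uf] := xinterp_exists u; have [g vg] := xinterp_exists (transpose v).
have -> : IV (u, v) = (f, transpose g).
  apply: the_uniqueE; first by apply/IV_interpP; rewrite //= transposeK.
  case=> f' g' /IV_interpP[] // uf' vg'; congr pair; first exact: xinterp_unique uf' uf.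
  by rewrite -[g']transposeK (xinterp_unique vg' vg).
move: (uf) (vg) => [Qf _ _] [Qg _ _].
have [P [sP sYP fP]] := (QspaceP _ _ _).1 Qf.
have [Q [sQ sYQ gQ]] := (QspaceP _ _ _).1 Qg.
subst f g.
(* The divergence of the interpolant, written with formal derivatives: it is polynomial on the whole
   plane, as membership in [Qspace] demands. *)
pose D := eval2 P^`() \+ transpose (eval2 Q^`()).
have QD : Qspace 2 2 D.
  apply: QspaceD; last apply: Qspace_transpose; apply/QspaceP.
    by exists P^`(); rewrite size_deriv_leq ?sizeY_deriv.
  by exists Q^`(); rewrite size_deriv_leq ?sizeY_deriv.
have [[_ _ cdu] [_ _ cdv]] := (cu, cv).
have mD : same_moments D (diverg (u, v)).
  have -> : diverg (u, v) = dx u \+ transpose (dx (transpose v)).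
    by apply/funext => z; rewrite /diverg /= dyE.
  apply: same_momentsD; [| | | | |apply: same_moments_transpose]; try exact: C0_eval2;
    try (apply: C0_transpose); try exact: C0_eval2; try by [];
    exact: xinterp_same_moments.
have -> : IQ (diverg (u, v)) = D.
  apply: the_uniqueE; first exact/IQ_interpP.
  move=> D' /IQ_interpP[QD' mD']; exact: same_moments_unique QD' QD mD' mD.
(* On the square, [dx] of a polynomial is its formal derivative, so the divergence of the
   interpolant is [D] there. *)
move=> [x y] rz; rewrite /diverg /D /= dyE transposeK dx_eval2 //; congr (_ + _).
by rewrite /transpose /= dx_eval2 // refsq_swap.
Qed.
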